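(* Let $p$ be a prime and $r$ a positive integer with $p'$-part $a$ and $p$-part $b$ (that is, $r=ab$ with $b$ a power of $p$ and $p\nmid a$). Then $$G(r,p)\cong G(a,p)\wr G(b,p)\cong S_a\wr D_b.$$
   Context: Write $[r]=\{1,\dots,r\}$. Let $N_\ell$ be the $\ell\times\ell$ matrix with $1$ in entries $(i,i+1)$, $1\le i<\ell$, and zeros elsewhere, and $J_\ell=I_\ell+N_\ell$ (unipotent Jordan block). For $1\le r\le s$ and a prime $p$, over any field of characteristic $p$ the Jordan canonical form of $J_r\otimes J_s$ is $\bigoplus_{i=1}^r J_{\lambda_i}$ with $\lambda_1\ge\cdots\ge\lambda_r>0$ and $\sum_i\lambda_i=rs$; the partition $\lambda(r,s,p):=(\lambda_1,\dots,\lambda_r)$ has exactly $r$ nonzero parts and depends only on $r,s,p$. The map $\pi(r,s,p):[r]\to[r]$ is the permutation $n\mapsto n^{\pi(r,s,p)}=(r+1-n)+s-\lambda_n$. $S_r$ is the symmetric group on $[r]$, and $G(r,p):=\langle \pi(r,s,p)\mid s\ge r\rangle\le S_r$ for $r\ge2$; by convention $G(1,p)=S_1=D_1$ is trivial. $D_b$ is the dihedral group of degree $b$, a subgroup of $S_b$: for $b\ge3$ it is the group of order $2b$ of symmetries of a regular $b$-gon acting on its $b$ vertices (numbered $1,\dots,b$ consecutively), and $D_b=S_b$ for $b=1,2$. For a group $H$ and a permutation group $K\le S_b$, $H\wr K=H^b\rtimes K$, where $K$ permutes the $b$ coordinates. *)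

(* Defs.v *)
From HB Require Import structures.
From mathcomp Require Import all_boot all_order all_algebra all_fingroup.
From mathcomp Require Import boolp mxtens.

Set Implicit Arguments.
Unset Strict Implicit.
Unset Printing Implicit Defensive.

Import GroupScope GRing.Theory.

Section JordanPartition.
Local Open Scope ring_scope.

Definition nilpotent_block (F : fieldType) (l : nat) : 'M[F]_l :=
  \matrix_(i < l, j < l) (i.+1 == j)%:R.

Definition jordan_block (F : fieldType) (l : nat) : 'M[F]_l :=
  1%:M + nilpotent_block F l.

(* [lam] is the partition of the Jordan form of J_r (x) J_s over F.  The cast  *)
(* identifies the index set of the block-diagonal matrix with that of the      *)
(* Kronecker product [*t].                                                     *)
Definition tensor_jordan_form (F : fieldType) (r s : nat) (lam : r.-tuple nat)
    : Prop :=
  exists e : (\sum_(i < r) tnth lam i = r * s)%N,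
    similar_in unitmx (jordan_block F r *t jordan_block F s)
      (castmx (e, e) (\mxdiag_(i < r) jordan_block F (tnth lam i))).

(* [lam] is lambda(r, s, p); lam_n is [tnth lam i] with n = i + 1.  The form   *)
(* does not depend on the field, so [lam] is required to work for all F.       *)
Definition is_lambda (r s p : nat) (lam : r.-tuple nat) : Prop :=
  [/\ sorted geq lam, all (leq 1) lam &
      forall F : fieldType, p \in [pchar F] -> tensor_jordan_form F s lam].

End JordanPartition.

(* [sigma] is pi(r, s, p), shifted from {1, ..., r} to 'I_r = {0, ..., r - 1}. *)
(* A relation, as it is a theorem that lambda(r, s, p) exists and that the     *)
(* formula defines a permutation.                                              *)
(* The subtraction of lam_n is truncated, but a truncated right-hand side      *)
(* would be 0, which is never a successor.                                     *)
Definition is_pi (r s p : nat) (sigma : 'S_r) : Prop :=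
  exists2 lam : r.-tuple nat, is_lambda s p lam &
    forall i : 'I_r, (sigma i).+1 = (r.+1 - i.+1) + s - tnth lam i.

(* For r = 1 the ambient group 'S_1 is trivial, hence so is [G_group 1 p]. *)
Definition G_group (r p : nat) : {group 'S_r} :=
  <<[set sigma : 'S_r | `[< exists2 s : nat, r <= s & is_pi s p sigma >]]>>%G.

(* Symmetries of the b-gon with vertices 0, ..., b - 1 in cyclic order,        *)
(* generated by the rotation i |-> i + 1 mod b and the reflection              *)
(* i |-> b - 1 - i.                                                            *)
Definition dihedral_group (b : nat) : {group 'S_b} :=
  if b <= 2 then [set: 'S_b]%G
  else <<[set perm (@ordS_inj b); perm (@rev_ord_inj b)]>>%G.

Section Wreath.
Variables (gT : finGroupType) (b : nat).

Definition coord_perm (f : {dffun forall _ : 'I_b, gT}) (s : 'S_b)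
    : {dffun forall _ : 'I_b, gT} := [ffun i => f (s^-1 i)].

Lemma coord_perm1 f : coord_perm f 1 = f.
Proof. by apply/ffunP=> i; rewrite ffunE invg1 perm1. Qed.

Lemma coord_permM f s t :
  coord_perm f (s * t) = coord_perm (coord_perm f s) t.
Proof. by apply/ffunP=> i; rewrite !ffunE invMg permM. Qed.

Canonical coord_perm_action := TotalAction coord_perm1 coord_permM.

Lemma coord_perm_is_groupAction : is_groupAction setT coord_perm_action.
Proof.
move=> s _; rewrite /= inE; apply/andP; split.
  by apply/subsetP=> f _; rewrite inE.
apply/morphicP=> f g _ _; rewrite !actpermE /=.
by apply/ffunP=> i; rewrite !(ffunE, mulg_ffun).
Qed.

Canonical coord_perm_groupAction := GroupAction coord_perm_is_groupAction.

Variables (H : {group gT}) (K : {group 'S_b}).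

(* H^b, with coordinates indexed by 'I_b *)
Definition base_group := [group of setXn (fun _ : 'I_b => H)].

Lemma coord_perm_acts : {acts K, on group base_group | coord_perm_groupAction}.
Proof.
split; last exact: subsetT.
apply/subsetP=> s _; rewrite !inE; apply/subsetP=> f /setXnP Hf.
by rewrite inE; apply/setXnP=> i; rewrite ffunE.
Qed.

(* [wreath_type] is the external semidirect product H^b ><| K, K permuting the *)
(* coordinates.                                                                *)
Definition wreath_type : finGroupType :=
  sdprod_groupType <[coord_perm_acts]>%gact.

Definition wreath : {group wreath_type} := [set: wreath_type]%G.

End Wreath.

(* Main.v *)
(* Put b = r`_p.  The Jordan type of J_r (x) J_s is that of the nilpotent        *)
(* operator N = (1 + X)(1 + Y) - 1 on F[X, Y]/(X^r, Y^s).                       *)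
(* Upper bound.  Let V_r be the module on which the generator of a cyclic       *)
(* p-group acts as J_r.  It is projective relative to the subgroup of the       *)
(* b-th powers, hence so is V_r (x) V_s, and every part of                      *)
(* lambda(r, s, p) is a multiple of b.  Then n^pi = s + 1 - n modulo b, so that *)
(* pi permutes the residue classes modulo b as a reflection of the b-gon; all   *)
(* permutations acting on the classes like an element of D_b form S_a wr D_b.   *)
(* Lower bound.  Let q >= r be a power of p.  For s = q, q + 1, q + b,          *)
(* q + b + 1 explicit cyclic vectors give lambda(r, s, p).  The first two       *)
(* permutations multiply to an r-cycle, and all four to a transposition of two  *)
(* points at distance b in that cycle.  Its conjugates generate the kernel of   *)
(* the action on residue classes, and the first two permutations induce all     *)
(* of D_b.                                                                      *)
Require Import Defs.
From mathcomp Require Import all_boot all_order all_algebra all_fingroup.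
From mathcomp Require Import mxtens zify boolp.
Set Implicit Arguments.
Unset Strict Implicit.
Unset Printing Implicit Defensive.
Import GRing.Theory.

(** * Relative projectivity in characteristic p *)

(** Otherwise [p ^ m] is coprime to the binomial coefficient; as it divides k times that
    coefficient, it would divide k. *)
Lemma prime_dvd_bin_expn p m k : prime p -> 0 < k < p ^ m -> p %| 'C(p ^ m, k).
Proof.
case: k => // k pr_p /= lt_k; apply: contraLR lt_k => p_ndiv_bin.
have co_p : coprime (p ^ m) 'C(p ^ m, k.+1).
  by rewrite coprimeXl // prime_coprime.
rewrite -leqNgt dvdn_leq // -(Gauss_dvdl _ co_p).
by rewrite -mul_bin_diag dvdn_mulr.
Qed.

Local Open Scope ring_scope.

Section CharacteristicP.
Variables (R : pzRingType) (p m : nat).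
Hypotheses (pr_p : prime p) (p0 : p%:R = 0 :> R).
Let b := (p ^ m)%N.
Let b_gt0 : (0 < b)%N. Proof. by rewrite expn_gt0 prime_gt0. Qed.

(** By Pascal's rule, consecutive coefficients add up to a binomial coefficient of b, which is 0 in
    R; so they alternate in sign. *)
Lemma natr_bin_pred_expn i : (i < b)%N -> (-1) ^+ i * 'C(b.-1, i)%:R = 1 :> R.
Proof.
elim: i => [|i IHi] lt_ib; first by rewrite bin0 mul1r.
have : 'C(b, i.+1)%:R = 0 :> R.
  have /dvdnP[c ->] : (p %| 'C(b, i.+1))%N by rewrite prime_dvd_bin_expn.
  by rewrite natrM p0 mulr0.
rewrite -{1}(prednK b_gt0) binS natrD => /eqP; rewrite addr_eq0 => /eqP->.
by rewrite exprS mulN1r mulrNN IHi // ltnW.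
Qed.

Lemma exprB_pred_expn (x y : R) : GRing.comm x y ->
  (x - y) ^+ b.-1 = \sum_(i < b) x ^+ (b.-1 - i) * y ^+ i.
Proof.
move=> cxy; rewrite exprBn_comm // (prednK b_gt0); apply: eq_bigr => i _.
by rewrite -mulrA -mulrnAl -mulr_natr natr_bin_pred_expn ?mul1r.
Qed.

Lemma exprB_expn (x y : R) : GRing.comm x y -> (x - y) ^+ b = x ^+ b - y ^+ b.
Proof.
by move=> cxy; rewrite subrXX_comm // -exprB_pred_expn // -exprS prednK.
Qed.

Lemma exprB1_expn (x : R) : (x - 1) ^+ b = x ^+ b - 1.
Proof. by rewrite exprB_expn ?expr1n //; apply: commr1. Qed.

Lemma expr1D_expn (x : R) : (1 + x) ^+ b = 1 + x ^+ b.
Proof.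
by rewrite -[x in RHS](addKr 1) (addrC (- 1)) exprB1_expn [RHS]addrC subrK.
Qed.

(** In the application x and v are multiplication by X and by 1 + Y, and n is N. *)
Variables (x v v' theta : R).
Hypotheses (vK : v * v' = 1) (vKV : v' * v = 1).
Hypotheses (cxv : GRing.comm x v) (ctv : GRing.comm theta v).
Hypothesis ctxb : GRing.comm theta (x ^+ b).
(** With g = 1 + x, the sum is unchanged when x is replaced by g: both sums are the (b - 1)-st power
    of left minus right multiplication. Hence for invertible g it is the sum of the conjugates of
    g^(b - 1) theta by g^i, a relative trace. *)
Hypothesis trace1 : \sum_(i < b) x ^+ (b.-1 - i) * theta * x ^+ i = 1.
Let n := (1 + x) * v - 1.

Let comm_inv (y : R) : GRing.comm y v -> GRing.comm y v'.
Proof.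
move=> cyv; rewrite /GRing.comm -[y in RHS]mulr1 -vK !mulrA -(mulrA v') cyv.
by rewrite !mulrA vKV mul1r.
Qed.

(** In characteristic p, n^b = (1 + x^b) v^b - 1 involves x only through x^b, with which theta
    commutes. *)
Lemma comm_higman : GRing.comm (v' ^+ b.-1 * theta) (n ^+ b).
Proof.
have cx1v : GRing.comm (1 + x) v.
  by apply/commr_sym/commrD; [apply: commr1 | apply: commr_sym].
have -> : n ^+ b = (1 + x ^+ b) * v ^+ b - 1.
  by rewrite /n exprB1_expn exprMn_comm // expr1D_expn.
apply: commrB; last exact: commr1.
have cv'v : GRing.comm v' v by rewrite /GRing.comm vK vKV.
apply/commr_sym/commrM; apply/commr_sym.
  apply/commr_sym/commrX/commr_sym/commrM; last exact: commrX.
  apply: commrD; first exact: commr1.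
  by apply/commrX/commr_sym/comm_inv.
apply: commrM; last exact: commrX.
by apply: commrD => //; apply: commr1.
Qed.

(* x - (v' - 1) is n up to a unit, and the (b - 1)-st power of a difference is  *)
(* the b-term sum of [exprB_pred_expn]: modulo left multiples of n, replacing   *)
(* the right factors x ^+ i of [trace1] by (v' - 1) ^+ i changes nothing.       *)
Lemma higman_decomposition :
  exists c, 1 = c * n + n ^+ b.-1 * (v' ^+ b.-1 * theta).
Proof.
pose t := v' - 1; pose d := x - t.
have cv'v : GRing.comm v' v by rewrite /GRing.comm vK vKV.
have cxt : GRing.comm x t by apply: commrB; [apply: comm_inv|apply: commr1].
have n_def : n = d * v.
  by rewrite /d /t opprB addrA (addrC x) mulrBl vKV.
have cdv : GRing.comm d v.
  apply: commr_sym; apply: commrB; first exact: commr_sym.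
  by apply: commrB; [apply: commr_sym|apply: commr1].
have ctt : GRing.comm theta t by apply: commrB; [apply: comm_inv|apply: commr1].
(* The inner sum is the quotient of x^i - t^i by d = x - t. *)
exists (\sum_(i < b) x ^+ (b.-1 - i) * theta *
   (\sum_(j < i) x ^+ (i.-1 - j) * t ^+ j) * v').
have -> : n ^+ b.-1 * (v' ^+ b.-1 * theta) = d ^+ b.-1 * theta.
  rewrite n_def exprMn_comm // mulrA -(mulrA (d ^+ _)) -exprMn_comm //.
  by rewrite vK expr1n mulr1.
rewrite exprB_pred_expn // mulr_suml mulr_suml -big_split /= -[LHS]trace1.
apply: eq_bigr => i _.
rewrite n_def cdv -!mulrA (mulrA v') vKV mul1r.
set S := \sum_(j < i) _.
have cSd : S * d = x ^+ i - t ^+ i.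
  rewrite subrXX_comm //; apply/commr_sym/commr_sum => j _.
  by apply: commrM; apply/commrX/commr_sym/commrB; rewrite ?cxt.
rewrite cSd mulrBr mulrBr !mulrA -(mulrA _ theta) -[_ * theta * t ^+ i]mulrA.
by rewrite -(mulrA _ _ theta) (commrX i ctt) subrK.
Qed.

End CharacteristicP.

Section NilpotentBlock.
Variables (F : fieldType) (r : nat).
Local Notation N := (nilpotent_block F r).

Lemma nilpotent_blockX k : N ^+ k = \matrix_(i, j) (i + k == j)%N%:R.
Proof.
elim: k => [|k IHk].
  by apply/matrixP=> i j; rewrite !mxE addn0.
rewrite exprS IHk; apply/matrixP=> i j; rewrite !mxE.
under eq_bigr => l _ do rewrite !mxE.
have [lt_ir | le_ri] := ltnP i.+1 r.
  rewrite (bigD1 (Ordinal lt_ir)) //= eqxx mul1r addSnnS big1 ?addr0 // => l.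
  by rewrite -val_eqE eq_sym /= => /negPf->; rewrite mul0r.
rewrite big1 => [|l _].
  rewrite gtn_eqF // (leq_trans (ltn_ord j)) // (leq_trans le_ri) //.
  by rewrite addnS ltnS leq_addr.
by rewrite gtn_eqF ?mul0r // (leq_trans (ltn_ord l)).
Qed.

Lemma nilpotent_block_nil k : (r <= k)%N -> N ^+ k = 0.
Proof.
move=> le_rk; rewrite nilpotent_blockX; apply/matrixP=> i j.
by rewrite !mxE gtn_eqF // (leq_trans (ltn_ord j)) // (leq_trans le_rk) ?leq_addl.
Qed.

Let natmx (f : nat -> nat -> F) : 'M[F]_r := \matrix_(i, j) f i j.

Let mul_nilpotent_blockX k (f : nat -> nat -> F) :
  N ^+ k *m natmx f =
  natmx (fun i j => if (i + k < r)%N then f (i + k)%N j else 0).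
Proof.
rewrite nilpotent_blockX; apply/matrixP=> i j; rewrite !mxE.
under eq_bigr => l _ do rewrite !mxE.
case: ltnP => [lt_ir | le_ri].
  rewrite (bigD1 (Ordinal lt_ir)) //= eqxx mul1r big1 ?addr0 // => l.
  by rewrite -val_eqE eq_sym /= => /negPf->; rewrite mul0r.
by rewrite big1 // => l _; rewrite gtn_eqF ?mul0r // (leq_trans (ltn_ord l)).
Qed.

Let mulX_nilpotent_block k (f : nat -> nat -> F) :
  natmx f *m N ^+ k =
  natmx (fun i j => if (k <= j)%N then f i (j - k)%N else 0).
Proof.
rewrite nilpotent_blockX; apply/matrixP=> i j; rewrite !mxE.
under eq_bigr => l _ do rewrite !mxE.
case: leqP => [le_kj | lt_jk].
  have lt_jr : (j - k < r)%N by rewrite (leq_ltn_trans (leq_subr _ _)).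
  rewrite (bigD1 (Ordinal lt_jr)) //= subnK // eqxx mulr1 big1 ?addr0 // => l.
  rewrite -val_eqE /= -(eqn_add2r k) subnK // => /negPf->.
  by rewrite mulr0.
by rewrite big1 // => l _; rewrite gtn_eqF ?mulr0 // (leq_trans lt_jk) ?leq_addl.
Qed.

Section Theta.
Variable b : nat.
Hypotheses (b_gt0 : (0 < b)%N) (b_dvd_r : (b %| r)%N).

Let theta_coef (i j : nat) : F := ((i == j + b.-1) && (b %| j))%N%:R.
(* In V_r = F[x]/(x^r), theta sends x^(bm + b - 1) to x^(bm) and kills the other *)
(* monomials.  It commutes with x^b, and its relative trace [theta_trace] is 1: *)
(* this is Higman's criterion for V_r to be projective relative to the subgroup *)
(* generated by the b-th power of the generator.                                *)
Definition theta : 'M[F]_r := \matrix_(i, j) theta_coef i j.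

Let dvd_ltn j : (j < r)%N -> (b %| j)%N -> (j + b <= r)%N.
Proof.
move=> lt_jr b_dvd_j; rewrite -leq_subRL ?(ltnW lt_jr) // dvdn_leq ?subn_gt0 //.
exact: dvdn_sub.
Qed.

(** Both products send x^i to x^(i + 1) if b divides i + 1 < r, and to 0 otherwise; at the end of
    the block this uses that b divides r. *)
Lemma theta_comm : GRing.comm theta (N ^+ b).
Proof.
rewrite /GRing.comm -!mulmxE -[theta]/(natmx theta_coef).
rewrite mulX_nilpotent_block mul_nilpotent_blockX.
apply/matrixP=> i j; rewrite !mxE /theta_coef.
transitivity (((i.+1 == j) && (b %| j))%N%:R : F).
  case: leqP => [le_bj | lt_jb].
    by rewrite -eqSS -addnS prednK // subnK // dvdn_subl.
  by case: eqP lt_jb => // <- lt_jb; rewrite gtnNdvd.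
have -> : (i + b == j + b.-1)%N = (i.+1 == j).
  by rewrite -{1}(prednK b_gt0) -addSnnS eqn_add2r.
case: ltnP => // le_rib; have [def_j|] := altP (i.+1 =P j) => //=.
have [b_dvd_j|//] := boolP (b %| j)%N.
have := dvd_ltn (ltn_ord j) b_dvd_j; rewrite -def_j addSn.
by rewrite ltnNge le_rib.
Qed.

(** On x^k only the summand with i = k modulo b survives: it sends x^k to x^(k - i + b - 1), then to
    x^(k - i), and back to x^k. The first exponent stays below r because b divides both k - i and
    r. *)
Lemma theta_trace :
  \sum_(i < b) N ^+ (b.-1 - i) * theta * N ^+ i = 1.
Proof.
apply/matrixP=> k l; rewrite summxE.
transitivity (\sum_(i < b) ((k == l) && (i == l %% b :> nat))%N%:R : F).
  apply: eq_bigr => i _; have lt_ib := ltn_ord i.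
  have le_ib : (i <= b.-1)%N by rewrite -ltnS prednK.
  rewrite -!mulmxE -[theta]/(natmx theta_coef) mul_nilpotent_blockX.
  rewrite mulX_nilpotent_block !mxE /theta_coef.
  case: (leqP i l) => [le_il | lt_li]; last first.
    have lt_mod : (l %% b < i)%N by exact: leq_ltn_trans (leq_mod l b) lt_li.
    by rewrite [i == _ :> nat]gtn_eqF ?andbF.
  have -> : (k + (b.-1 - i) == l - i + b.-1)%N = (k == l).
    by rewrite -(eqn_add2r i) -addnA subnK // addnAC subnK // eqn_add2r.
  have -> : (b %| l - i)%N = (i == l %% b :> nat)%N.
    by rewrite -eqn_mod_dvd // (modn_small lt_ib) eq_sym.
  case: ltnP => // le_r; case: eqP => //= k_def; case: eqP => //= i_def.
  have := @dvd_ltn (l - i)%N (leq_ltn_trans (leq_subr _ _) (ltn_ord l)).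
  rewrite -eqn_mod_dvd // (modn_small lt_ib) i_def eqxx => /(_ isT).
  rewrite leqNgt -i_def (leq_ltn_trans le_r) // k_def.
  by rewrite -(ltn_add2r i) -addnA subnK // addnAC subnK // ltn_add2l prednK.
rewrite (bigD1 (Ordinal (ltn_pmod l b_gt0))) //= eqxx andbT big1 ?addr0 ?mxE // => i.
by rewrite -val_eqE /= => /negPf->; rewrite andbF.
Qed.

End Theta.
End NilpotentBlock.

(* xi and eta are the first and last vectors of a Jordan block of size k.  If   *)
(* b does not divide k, then inserting the decomposition of 1 between xi and    *)
(* A ^+ k.-1 *m eta kills both terms: A ^+ (b * (k %/ b)) moves across t.       *)
Lemma relatively_projective_dvd (F : fieldType) (n b k : nat) (A c t : 'M[F]_n)
    (xi : 'rV_n) (eta : 'cV_n) :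
  (0 < b)%N -> (0 < k)%N ->
  1 = c * A + A ^+ b.-1 * t -> GRing.comm t (A ^+ b) ->
  xi *m A ^+ k = 0 -> A ^+ k *m eta = 0 -> xi *m A ^+ k.-1 *m eta != 0 ->
  (b %| k)%N.
Proof.
move=> b_gt0 k_gt0 one_dec ct xiA0 Aeta0; apply: contraNT => b_ndvd_k.
rewrite -[xi]mulmx1 -[1%:M]/(1 : 'M_n) one_dec mulmxDr !mulmxDl.
have AX : A *m A ^+ k.-1 = A ^+ k by rewrite mulmxE -exprS prednK.
rewrite -!mulmxE -!mulmxA [A *m (_ *m _)]mulmxA AX Aeta0 !mulmx0 add0r.
have k_def : (k.-1 = b * (k %/ b) + (k %% b).-1)%N.
  have kmod_gt0 : (0 < k %% b)%N by rewrite lt0n.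
  by rewrite {1}(divn_eq k b) mulnC -(prednK kmod_gt0) addnS.
have le_k : (k <= b.-1 + b * (k %/ b))%N.
  by rewrite {1}(divn_eq k b) mulnC addnC leq_add2r -ltnS prednK // ltn_mod.
have {}xiA0 j : (k <= j)%N -> xi *m A ^+ j = 0.
  by move=> le_kj; rewrite -(subnKC le_kj) exprD -mulmxE mulmxA xiA0 mul0mx.
rewrite k_def exprD exprM -!mulmxE -mulmxA [t *m _]mulmxA mulmxE.
rewrite (commrX _ ct) -exprM -mulmxE !mulmxA -[xi *m _ *m _]mulmxA.
by rewrite mulmxE -exprD xiA0 // !mul0mx.
Qed.

Section Tensor.
Variables (F : fieldType) (r s : nat).
Implicit Types (A : 'M[F]_r) (B : 'M[F]_s).

Definition tensl A : 'M[F]_(r * s) := A *t (1%:M : 'M_s).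
Definition tensr B : 'M[F]_(r * s) := (1%:M : 'M_r) *t B.

Lemma tenslD A A' : tensl (A + A') = tensl A + tensl A'.
Proof. by apply/matrixP=> i j; rewrite !mxE mulrDl. Qed.

Lemma tensrD B B' : tensr (B + B') = tensr B + tensr B'.
Proof. by apply/matrixP=> i j; rewrite !mxE mulrDr. Qed.

Lemma tensmx11 : (1%:M : 'M[F]_r) *t (1%:M : 'M[F]_s) = 1%:M.
Proof.
apply/matrixP=> i j; case: (mxtens_indexP i) => i1 i2.
case: (mxtens_indexP j) => j1 j2.
by rewrite tensmxE !mxE (can_eq (@mxtens_indexK _ _)) xpair_eqE -natrM mulnb.
Qed.

Lemma tenslM A A' : tensl (A * A') = tensl A * tensl A'.
Proof. by rewrite -!mulmxE /tensl tensmx_mul mulmx1. Qed.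

Lemma tensrM B B' : tensr (B * B') = tensr B * tensr B'.
Proof. by rewrite -!mulmxE /tensr tensmx_mul mulmx1. Qed.

Lemma tensl1 : tensl 1 = 1. Proof. exact: tensmx11. Qed.
Lemma tensr1 : tensr 1 = 1. Proof. exact: tensmx11. Qed.

Lemma tenslX A k : tensl (A ^+ k) = tensl A ^+ k.
Proof. by elim: k => [|k IHk]; rewrite ?tensl1 // !exprS tenslM IHk. Qed.

Lemma tensrX B k : tensr (B ^+ k) = tensr B ^+ k.
Proof. by elim: k => [|k IHk]; rewrite ?tensr1 // !exprS tensrM IHk. Qed.

Lemma tensl_sum (I : Type) (e : seq I) (P : pred I) (A_ : I -> 'M[F]_r) :
  tensl (\sum_(i <- e | P i) A_ i) = \sum_(i <- e | P i) tensl (A_ i).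
Proof. by apply: (big_morph tensl tenslD); apply: tens0mx. Qed.

Lemma tensl_tensr_comm A B : GRing.comm (tensl A) (tensr B).
Proof.
by rewrite /GRing.comm -!mulmxE /tensl /tensr !tensmx_mul !mul1mx !mulmx1.
Qed.

Definition shiftl := tensl (nilpotent_block F r).
Definition shiftr := tensr (nilpotent_block F s).
Definition tensor_nilp : 'M[F]_(r * s) := (1 + shiftl) * (1 + shiftr) - 1.

Lemma tensor_nilpE : jordan_block F r *t jordan_block F s = 1 + tensor_nilp.
Proof.
rewrite /tensor_nilp addrC subrK -{1}tensl1 -tensr1 -tenslD -tensrD.
by rewrite -mulmxE /tensl /tensr tensmx_mul mulmx1 mul1mx.
Qed.

Lemma shiftl_nil k : (r <= k)%N -> shiftl ^+ k = 0.
Proof.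
by move=> le_rk; rewrite -tenslX nilpotent_block_nil // /tensl tens0mx.
Qed.

Lemma shiftr_nil k : (s <= k)%N -> shiftr ^+ k = 0.
Proof.
by move=> le_sk; rewrite -tensrX nilpotent_block_nil // /tensr tensmx0.
Qed.

Lemma shift_comm : GRing.comm shiftl shiftr.
Proof. exact: tensl_tensr_comm. Qed.

Section Projective.
Variables (p m : nat).
Hypotheses (pr_p : prime p) (p0 : p \in [pchar F]) (b_dvd_r : (p ^ m %| r)%N).

Lemma natr_mx0 k : p%:R = 0 :> 'M[F]_k.
Proof.
apply/matrixP=> i j.
by rewrite mulmxnE !mxE -mulrnA mulnC mulrnA (pcharf0 p0) mul0rn.
Qed.

(** Tensoring [theta] with the identity of V_s keeps its trace equal to 1 and makes it commute with
    1 + Y. *)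
Lemma tensor_nilp_relatively_projective :
  exists c t, 1 = c * tensor_nilp + tensor_nilp ^+ (p ^ m).-1 * t
           /\ GRing.comm t (tensor_nilp ^+ (p ^ m)).
Proof.
set b := (p ^ m)%N; have b_gt0 : (0 < b)%N by rewrite expn_gt0 prime_gt0.
(* The inverse of 1 + Y, as a geometric series that stops at Y^s = 0. *)
pose v' := \sum_(i < s) 1 ^+ (s.-1 - i) * (- shiftr) ^+ i.
have c1r : GRing.comm 1 (- shiftr) by apply/commr_sym/commr1.
have vK : (1 + shiftr) * v' = 1.
  have := subrXX_comm s c1r; rewrite opprK => <-.
  by rewrite expr1n exprNn shiftr_nil // mulr0 subr0.
have vKV : v' * (1 + shiftr) = 1.
  rewrite -[RHS]vK; apply: commr_sym; apply: commr_sum => i _.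
  rewrite expr1n mul1r; apply/commrX/commrN/commr_sym/commrD => //.
  exact: commr1.
have ctv : GRing.comm (tensl (theta F r b)) (1 + shiftr).
  by apply: commrD; [apply: commr1 | apply: tensl_tensr_comm].
have clv : GRing.comm shiftl (1 + shiftr).
  by apply: commrD; [apply: commr1 | apply: shift_comm].
have ctl : GRing.comm (tensl (theta F r b)) (shiftl ^+ b).
  by rewrite -tenslX /GRing.comm -!tenslM (theta_comm F b_gt0 b_dvd_r).
have trace1 :
    \sum_(i < b) shiftl ^+ (b.-1 - i) * tensl (theta F r b) * shiftl ^+ i = 1.
  rewrite -tensl1 -(theta_trace F b_gt0 b_dvd_r) tensl_sum.
  by apply: eq_bigr => i _; rewrite !tenslM !tenslX.
have p0' := natr_mx0 (r * s).
have [c c_def] := higman_decomposition pr_p p0' vK vKV clv ctv trace1.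
exists c, (v' ^+ b.-1 * tensl (theta F r b)); split=> //.
exact: (comm_higman pr_p p0' vK vKV clv ctv ctl).
Qed.

End Projective.
End Tensor.

(** * Jordan forms and cyclic vectors *)

Section JordanForm.
Variables (F : fieldType) (r : nat) (lam : 'I_r -> nat).
Local Notation N l := (nilpotent_block F l).

(** The rows of P form a Jordan basis and the columns of its inverse the dual one. In block i, xi is
    the first basis vector and eta is dual to the last, which is the image of xi under the highest
    nonzero power. *)
Lemma jordan_block_vectors (n : nat) (A : 'M[F]_n)
    (e : (\sum_(i < r) lam i = n)%N) :
  similar_in unitmx (1 + A)
    (castmx (e, e) (\mxdiag_(i < r) jordan_block F (lam i))) ->
  forall i, (0 < lam i)%N -> exists xi : 'rV_n, exists eta : 'cV_n,
  [/\ xi *m A ^+ lam i = 0, A ^+ lam i *m eta = 0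
    & xi *m A ^+ (lam i).-1 *m eta != 0].
Proof.
case: n / e A => A; rewrite castmx_id => -[P uP /(similarP uP) PA] i lam_gt0.
pose Q := invmx P; pose Pi := submxcol P i; pose Qi := submxrow Q i.
have PQ : Pi *m Qi = 1%:M.
  have := mulmxV uP; rewrite -/Q -{1}[P]submxcolK -{1}[Q]submxrowK mul_mxcol_mxrow.
  rewrite -(mxdiagZ 1) => /(congr1 (fun M => submxblock M i i)).
  by rewrite mxblockK submxblock_diag.
have PiA : Pi *m A = N (lam i) *m Pi.
  move: PA; rewrite -{1 2}[P]submxcolK mxcol_mul mul_mxdiag_mxcol.
  move=> /eq_mxcolP/(_ i); rewrite -/Pi mulmxDr mulmx1 mulmxDl mul1mx.
  by move/addrI.
have QiA : A *m Qi = Qi *m N (lam i).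
  have : (1 + A) *m Q = Q *m \mxdiag_(i < r) jordan_block F (lam i).
    by rewrite -[LHS](mulKmx uP) [P *m _]mulmxA PA mulmxK.
  rewrite -{1 2}[Q]submxrowK mul_mxrow mul_mxrow_mxdiag.
  move=> /eq_mxrowP/(_ i); rewrite -/Qi mulmxDr mulmx1 mulmxDl mul1mx.
  by move/addrI.
have PiAX k : Pi *m A ^+ k = N (lam i) ^+ k *m Pi.
  elim: k => [|k IHk]; first by rewrite mulmx1 mul1mx.
  by rewrite exprS -mulmxE mulmxA PiA -mulmxA IHk mulmxA mulmxE -exprS.
have QiAX k : A ^+ k *m Qi = Qi *m N (lam i) ^+ k.
  elim: k => [|k IHk]; first by rewrite mulmx1 mul1mx.
  by rewrite exprSr -mulmxE -mulmxA QiA mulmxA IHk -mulmxA mulmxE -exprSr.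
have lt_lam : ((lam i).-1 < lam i)%N by rewrite prednK.
exists (row (Ordinal lam_gt0) Pi), (col (Ordinal lt_lam) Qi).
rewrite rowE colE -!mulmxA PiAX (mulmxA (A ^+ _)) QiAX nilpotent_block_nil //.
rewrite mul0mx !mulmx0 mul0mx; split=> //.
rewrite (mulmxA (A ^+ _)) (mulmxA Pi) (mulmxA Pi) PiAX -(mulmxA _ Pi) PQ mulmx1.
apply/eqP=> /matrixP/(_ 0 0); rewrite -colE -rowE nilpotent_blockX !mxE add0n eqxx.
by apply/eqP; rewrite oner_eq0.
Qed.

(* The last hypothesis says that the v i generate modulo the image of A; as A   *)
(* is nilpotent, they generate everything, and by the dimension count e the     *)
(* vectors v i *m A ^+ j with j < lam i form a basis.                           *)
Lemma jordan_form_of_cyclic_vectors (n : nat) (A : 'M[F]_n)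
    (v : 'I_r -> 'rV_n) m (e : (\sum_(i < r) lam i = n)%N) :
  A ^+ m = 0 -> (forall i, v i *m A ^+ lam i = 0) ->
  (1%:M <= \sum_i <<v i>> + A)%MS ->
  similar_in unitmx (1 + A)
    (castmx (e, e) (\mxdiag_(i < r) jordan_block F (lam i))).
Proof.
case: n / e A v => A v A0 vA0 spanA; rewrite castmx_id.
pose P_ i : 'M_(lam i, _) := \matrix_(j < lam i) (v i *m A ^+ j).
pose P := \mxcol_i P_ i.
have PA_ i : P_ i *m A = N (lam i) *m P_ i.
  apply/row_matrixP=> j; rewrite row_mul rowK -mulmxA mulmxE -exprSr.
  rewrite row_mul.
  have [lt_j | le_j] := ltnP j.+1 (lam i).
    have -> : row j (N (lam i)) = delta_mx 0 (Ordinal lt_j).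
      by apply/rowP=> k; rewrite !mxE eqxx andTb eq_sym.
    by rewrite -rowE rowK.
  have -> : row j (N (lam i)) = 0.
    by apply/rowP=> k; rewrite !mxE gtn_eqF // (leq_trans (ltn_ord k)).
  by rewrite mul0mx -(subnKC le_j) exprD -mulmxE mulmxA vA0 mul0mx.
have PA : P *m (1 + A) = \mxdiag_(i < r) jordan_block F (lam i) *m P.
  rewrite /P mxcol_mul mul_mxdiag_mxcol; apply/eq_mxcolP=> i.
  by rewrite mulmxDr mulmx1 mulmxDl mul1mx PA_.
have stableP : (P *m A <= P)%MS.
  have -> : P *m A = (\mxdiag_(i < r) jordan_block F (lam i) - 1) *m P.
    by rewrite mulmxBl mul1mx -PA mulmxDr mulmx1 addrC addKr.
  exact: submxMl.
have vP i : (v i <= P)%MS.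
  have [lam0 | lam_gt0] := posnP (lam i).
    by have := vA0 i; rewrite lam0 mulmx1 => ->; apply: sub0mx.
  rewrite eqmx_col (sumsmx_sup i) // genmxE.
  by have := row_sub (Ordinal lam_gt0) (P_ i); rewrite rowK mulmx1.
have {}spanA : (1%:M <= P + A)%MS.
  apply: submx_trans spanA _; rewrite addsmxS //.
  by apply/sumsmx_subP=> i _; rewrite genmxE.
have stablePX k : (P *m A ^+ k <= P)%MS.
  elim: k => [|k IHk]; first by rewrite mulmx1.
  by rewrite exprSr -mulmxE mulmxA (submx_trans (submxMr _ IHk)).
have spanX k : (1%:M <= P + A ^+ k)%MS.
  elim: k => [|k IHk]; first by rewrite addsmxSr.
  apply: submx_trans IHk _; rewrite addsmx_sub addsmxSl /=.
  have := submxMr (A ^+ k) spanA; rewrite mul1mx => /submx_trans; apply.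
  rewrite addsmxMr addsmx_sub (submx_trans (stablePX k)) ?addsmxSl //=.
  by rewrite mulmxE -exprS addsmxSr.
have uP : P \in unitmx.
  by have := spanX m; rewrite A0 addsmx0 -row_full_unit -sub1mx.
by exists P => //; apply/(similarP uP).
Qed.

End JordanForm.

Lemma tensor_jordan_form_dvd (F : fieldType) (r s p m : nat)
    (lam : r.-tuple nat) i :
  prime p -> p \in [pchar F] -> (p ^ m %| r)%N -> tensor_jordan_form F s lam ->
  (0 < tnth lam i)%N -> (p ^ m %| tnth lam i)%N.
Proof.
move=> pr_p pcharFp dvd_r [e]; rewrite tensor_nilpE => sim lam_gt0.
have [xi [eta [xi0 eta0 xi_eta]]] := jordan_block_vectors sim lam_gt0.
have [c [t [one_dec ct]]] :=
  tensor_nilp_relatively_projective s pr_p pcharFp dvd_r.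
apply: relatively_projective_dvd one_dec ct xi0 eta0 xi_eta => //.
by rewrite expn_gt0 prime_gt0.
Qed.

(** * Monomials modulo the image of N *)

Section Spanning.
Variables (F : fieldType) (r s : nat).
Hypotheses (r_gt0 : (0 < r)%N) (s_gt0 : (0 < s)%N).
Local Notation X := (shiftl F r s).
Local Notation Y := (shiftr F r s).
Local Notation N := (tensor_nilp F r s).

Definition origin : 'rV[F]_(r * s) :=
  delta_mx 0 (mxtens_index (Ordinal r_gt0, Ordinal s_gt0)).
Definition monomial i j := origin *m (X ^+ i * Y ^+ j).

Lemma monomial_delta (i : 'I_r) (j : 'I_s) :
  monomial i j = delta_mx 0 (mxtens_index (i, j)).
Proof.
rewrite /monomial -tenslX -tensrX -mulmxE /tensl /tensr tensmx_mul mulmx1 mul1mx.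
rewrite -rowE; apply/rowP=> k; case: (mxtens_indexP k) => k1 k2.
rewrite mxE tensmxE !nilpotent_blockX !mxE !add0n eqxx andTb.
rewrite (can_eq (@mxtens_indexK _ _)) xpair_eqE -natrM mulnb.
by rewrite !(eq_sym k1) (eq_sym k2).
Qed.

Lemma tensor_nilp_expand : N = X + Y + X * Y.
Proof.
rewrite /tensor_nilp mulrDl mul1r mulrDr mulr1 addrAC [1 + Y]addrC addrK.
by rewrite addrA [Y + X]addrC.
Qed.

Lemma monomial_nilp i j :
  monomial i j *m N = monomial i.+1 j + monomial i j.+1 + monomial i.+1 j.+1.
Proof.
rewrite /monomial -!mulmxDr -mulmxA; congr (_ *m _); rewrite mulmxE.
have cYX : GRing.comm (Y ^+ j) X by apply/commr_sym/commrX/shift_comm.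
rewrite tensor_nilp_expand !mulrDr; congr (_ + _ + _).
- by rewrite -mulrA cYX mulrA -exprSr.
- by rewrite -mulrA -exprSr.
- by rewrite mulrA -[_ * X]mulrA cYX mulrA -exprSr -mulrA -exprSr.
Qed.

Lemma monomial_nil i j : (r <= i)%N || (s <= j)%N -> monomial i j = 0.
Proof.
rewrite /monomial => /orP[/shiftl_nil->|/shiftr_nil->].
  by rewrite mul0r mulmx0.
by rewrite mulr0 mulmx0.
Qed.

(* Descending induction on the total degree.  By [monomial_nilp], modulo the    *)
(* image of N and higher degrees all monomials of degree d agree up to sign;    *)
(* one of them is X^d * Y^0 = 0 if d >= r, and X^0 * Y^d is given if d < r.     *)
Lemma monomial_span (W : 'M_(r * s)) :
  (forall j, (j < r)%N -> (monomial 0 j <= W + N)%MS) -> (1%:M <= W + N)%MS.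
Proof.
move=> genW.
have nilpW i j :
    ((monomial i.+1 j + monomial i j.+1 + monomial i.+1 j.+1)%R <= W + N)%MS.
  by rewrite -monomial_nilp (submx_trans (submxMl _ _)) ?addsmxSr.
have subW (u v : 'rV_(r * s)) :
    ((u + v)%R <= W + N -> v <= W + N -> u <= W + N)%MS.
  by move=> uvW vW; rewrite -(addrK v u) addmx_sub // eqmx_opp.
suff monoW d i j : (r + s <= i + j + d)%N -> (monomial i j <= W + N)%MS.
  apply/row_subP=> k; rewrite row1; case: (mxtens_indexP k) => i j.
  by rewrite -monomial_delta (monoW (r + s)%N) // leq_addl.
elim: d i j => [|d IHd] i j le_rs.
  rewrite monomial_nil ?sub0mx //; case: leqP => //= lt_ir.
  by rewrite -(leq_add2l r) (leq_trans le_rs) // addn0 leq_add2r ltnW.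
have [lt_r | le_r] := ltnP (i + j) r.
  elim: i j lt_r le_rs => [|i IHi] j lt_r le_rs; first exact: genW.
  apply: (subW _ (monomial i j.+1)); last by apply: IHi; rewrite -(addSnnS i j).
  apply: (subW _ _ (nilpW i j)).
  by apply: IHd; rewrite (addnS i.+1 j) addSnnS.
have [k def_k] : exists k, (i + k >= r)%N by exists r; rewrite leq_addl.
elim: k i j def_k le_r le_rs => [|k IHk] i j le_rk le_r le_rs.
  by rewrite monomial_nil ?sub0mx // -(addn0 i) le_rk.
have [le_ri | lt_ir] := leqP r i; first by rewrite monomial_nil ?sub0mx ?le_ri.
case: j => [|j] in le_r le_rs *; first by rewrite addn0 leqNgt lt_ir in le_r.
apply: (subW _ (monomial i.+1 j)); last first.
  by apply: IHk; rewrite ?(addSnnS i).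
rewrite addrC; apply: (subW _ _ (nilpW i j)).
by apply: IHd; rewrite (addSnnS i) (addnS i) addSnnS.
Qed.

End Spanning.

(** * The partitions for s = q, q + 1, q + b, q + b + 1 *)

Section NilpPower.
Variables (F : fieldType) (r s p : nat).
Hypotheses (r_gt0 : (0 < r)%N) (s_gt0 : (0 < s)%N).
Hypotheses (pr_p : prime p) (pcharFp : p \in [pchar F]).
Local Notation w := (monomial F r_gt0 s_gt0).
Local Notation N := (tensor_nilp F r s).

(** Raising 1 + N = (1 + X)(1 + Y) to the b-th power in characteristic p gives N^b = X^b + Y^b + X^b
    Y^b. *)
Lemma monomial_nilpX m i j (b := (p ^ m)%N) :
  w i j *m N ^+ b = w (i + b)%N j + w i (j + b)%N + w (i + b)%N (j + b)%N.
Proof.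
have c11 : GRing.comm (1 + shiftl F r s) (1 + shiftr F r s).
  apply: commrD; first exact: commr1.
  apply/commr_sym/commrD; first exact: commr1.
  exact/commr_sym/shift_comm.
set x := shiftl F r s in c11 *; set y := shiftr F r s in c11 *.
have NX : N ^+ b = x ^+ b + y ^+ b + x ^+ b * y ^+ b.
  have p0 := natr_mx0 pcharFp (r * s).
  rewrite /tensor_nilp (exprB1_expn m pr_p p0) exprMn_comm //.
  rewrite !(expr1D_expn m pr_p p0) mulrDl mul1r mulrDr mulr1 addrAC.
  by rewrite [1 + y ^+ _]addrC addrK addrA [X in X + _]addrC.
have cYX : GRing.comm (y ^+ j) (x ^+ b).
  by apply/commrX/commr_sym/commrX/shift_comm.
rewrite /monomial -!mulmxDr -mulmxA; congr (_ *m _); rewrite mulmxE NX !mulrDr.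
congr (_ + _ + _).
- by rewrite -mulrA cYX mulrA -exprD.
- by rewrite -mulrA -exprD.
- by rewrite mulrA -[_ * x ^+ b]mulrA cYX mulrA -exprD -mulrA -exprD.
Qed.

Lemma monomial_nilpX_top m i j k (b := (p ^ m)%N) :
  (s <= j + b)%N -> w i j *m N ^+ (b * k) = w (i + b * k)%N j.
Proof.
move=> le_s; elim: k => [|k IHk]; first by rewrite muln0 mulmx1 addn0.
rewrite mulnSr exprD -mulmxE mulmxA IHk monomial_nilpX.
rewrite !(monomial_nil _ r_gt0 s_gt0 (j := (j + b)%N)) ?le_s ?orbT // !addr0.
by rewrite -addnA -mulnSr.
Qed.

(** Y^(j + 2b) vanishes, so (X^b + Y^b (1 + X^b))^(k + 1) only matters up to its linear term in Y^b;
    its coefficient k + 1 will become a. *)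
Lemma monomial_nilpX_top2 m i j k (b := (p ^ m)%N) :
  (s <= j + b + b)%N ->
  w i j *m N ^+ (b * k.+1) = w (i + b * k.+1)%N j +
     (w (i + b * k)%N (j + b)%N + w (i + b * k.+1)%N (j + b)%N) *+ k.+1.
Proof.
move=> le_s; elim: k => [|k IHk].
  by rewrite muln1 monomial_nilpX muln0 addn0 addrA.
rewrite (mulnSr b k.+1) exprD -mulmxE mulmxA IHk mulmxDl -scaler_nat -scalemxAl.
rewrite mulmxDl !monomial_nilpX.
rewrite !(monomial_nil _ r_gt0 s_gt0 (j := (j + b + b)%N)) ?le_s ?orbT //.
rewrite !addr0.
rewrite -!addnA -!mulnSr scaler_nat [in RHS]mulrS.
by rewrite -!addrA.
Qed.

(** Since X^q = 0, N^q is multiplication by Y^q. *)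
Lemma monomial_nilpX_shift n i j k (q := (p ^ n)%N) :
  (r <= q)%N -> w i j *m N ^+ (q * k) = w i (j + q * k)%N.
Proof.
move=> le_rq; elim: k => [|k IHk]; first by rewrite muln0 mulmx1 addn0.
rewrite mulnSr exprD -mulmxE mulmxA IHk monomial_nilpX.
rewrite !(monomial_nil _ r_gt0 s_gt0 (i := (i + q)%N));
  rewrite ?(leq_trans le_rq) ?leq_addl //.
by rewrite add0r addr0 addnA.
Qed.

Lemma tensor_nilp_nil n (q := (p ^ n)%N) : (r <= q)%N -> N ^+ (q * s) = 0.
Proof.
move=> le_rq; apply/row_matrixP=> k; rewrite rowE row0.
case: (mxtens_indexP k) => i j; rewrite -(monomial_delta _ r_gt0 s_gt0).
rewrite monomial_nilpX_shift // monomial_nil //.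
rewrite orbC -{1}(mul1n s) (leq_trans _ (leq_addl _ _)) //.
by rewrite leq_mul2r expn_gt0 prime_gt0 ?orbT.
Qed.

End NilpPower.

(** By [monomial_span], 1, Y, ..., Y^(r - 1) generate modulo the image of N, so each Y^i may be
    corrected by an element of that image to get a vector killed by the right power of N. *)
Lemma tensor_jordan_formI (F : fieldType) (r s p n : nat) (lam : r.-tuple nat)
    (r_gt0 : (0 < r)%N) (s_gt0 : (0 < s)%N) (v : 'I_r -> 'rV[F]_(r * s)) :
  prime p -> p \in [pchar F] -> (r <= p ^ n)%N ->
  (\sum_(i < r) tnth lam i = r * s)%N ->
  (forall i, v i *m tensor_nilp F r s ^+ tnth lam i = 0) ->
  (forall i : 'I_r,
     ((monomial F r_gt0 s_gt0 0 i - v i)%R <= tensor_nilp F r s)%MS) ->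
  tensor_jordan_form F s lam.
Proof.
move=> pr_p pcharFp le_rq e v0 vN; exists e; rewrite tensor_nilpE.
apply: jordan_form_of_cyclic_vectors v0 _.
  exact: (tensor_nilp_nil r_gt0 s_gt0 pr_p pcharFp le_rq).
apply: monomial_span => j lt_jr.
rewrite -[monomial _ _ _ _ _](subrK (v (Ordinal lt_jr))) addmx_sub //.
  by rewrite (submx_trans (vN (Ordinal lt_jr))) ?addsmxSr.
rewrite (submx_trans _ (addsmxSl _ _)) //.
by rewrite (sumsmx_sup (Ordinal lt_jr)) // genmxE.
Qed.

Lemma sum_ord_ltn r c : (c <= r)%N -> (\sum_(i < r) (i < c)%N)%N = c.
Proof.
move=> le_cr; rewrite -[RHS]card_ord -sum1_card.
rewrite (big_ord_widen r (fun=> 1%N) le_cr) [RHS]big_mkcond.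
by apply: eq_bigr => i _; case: ltnP.
Qed.

Lemma sorted_geq_mktuple r (f : nat -> nat) :
  (forall i j, (i < j)%N -> (f j <= f i)%N) -> sorted geq [tuple f i | i < r].
Proof.
move=> f_anti; have -> : [tuple f i | i < r] = map f (iota 0 r) :> seq nat.
  by rewrite -val_enum_ord -map_comp.
by apply: (homo_sorted f_anti); apply: iota_ltn_sorted.
Qed.

Section Lambda.
Variables (p n r : nat).
Hypotheses (pr_p : prime p) (r_gt0 : (0 < r)%N).
Let q := (p ^ n)%N.
Hypothesis le_rq : (r <= q)%N.
Let q_gt0 : (0 < q)%N. Proof. by rewrite expn_gt0 prime_gt0. Qed.

Definition lambda_q : r.-tuple nat := [tuple q | i < r].

Lemma is_lambda_q : is_lambda q p lambda_q.
Proof.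
split=> [||F pcharFp]; first exact: (@sorted_geq_mktuple r (fun=> q)).
  by apply/allP=> _ /mapP[i _ ->].
apply: (tensor_jordan_formI (r_gt0 := r_gt0) (s_gt0 := q_gt0)
         (v := fun i => monomial F r_gt0 q_gt0 0 i) pr_p pcharFp le_rq) => [|i|i].
- under eq_bigr => i _ do rewrite tnth_mktuple.
  by rewrite sum_nat_const card_ord.
- rewrite tnth_mktuple -[q in _ ^+ q]muln1 monomial_nilpX_shift // monomial_nil //.
  by rewrite muln1 leq_addl orbT.
- by rewrite subrr sub0mx.
Qed.

Section PPower.
Variable m : nat.
Let b := (p ^ m)%N.
Hypothesis b_dvd_r : (b %| r)%N.
Let b_gt0 : (0 < b)%N. Proof. by rewrite expn_gt0 prime_gt0. Qed.
Let le_br : (b <= r)%N. Proof. exact: dvdn_leq. Qed.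

Let f i := if (i < b)%N then (q + r)%N else q.

Definition lambda_qb : r.-tuple nat := [tuple f i | i < r].

(** The vectors Y^i serve. N^q takes Y^i to Y^(q + i), which is 0 for i >= b; for i < b, N^b acts on
    it as X^b, and X^r = 0. The case m = 0 gives s = q + 1. *)
Lemma is_lambda_qb : is_lambda (q + b) p lambda_qb.
Proof.
have s_gt0 : (0 < q + b)%N by rewrite addn_gt0 q_gt0.
split=> [||F pcharFp].
- apply: sorted_geq_mktuple => i j lt_ij; rewrite /f.
  by case: ltnP => lt_jb; case: ltnP => lt_ib; lia.
- by apply/allP=> _ /mapP[i _ ->]; rewrite /f; case: ifP; rewrite ?addn_gt0 q_gt0.
apply: (tensor_jordan_formI (r_gt0 := r_gt0) (s_gt0 := s_gt0)
         (v := fun i => monomial F r_gt0 s_gt0 0 i) pr_p pcharFp le_rq) => [|i|i].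
- transitivity (\sum_(i < r) (q + r * (i < b)%N))%N.
    by apply: eq_bigr => i _; rewrite tnth_mktuple /f; case: ltnP => _ /=; lia.
  by rewrite big_split -big_distrr sum_ord_ltn //= sum_nat_const card_ord mulnDr.
- rewrite tnth_mktuple /f; case: ltnP => [lt_ib | le_bi].
    rewrite exprD -mulmxE mulmxA -[q in _ ^+ q]muln1 monomial_nilpX_shift //.
    have r_eq : r = (b * (r %/ b))%N by rewrite mulnC divnK.
    rewrite [X in _ ^+ X]r_eq monomial_nilpX_top //; last by rewrite muln1; lia.
    by rewrite monomial_nil // -r_eq leqnn.
  rewrite -[q in _ ^+ q]muln1 monomial_nilpX_shift // muln1 monomial_nil //.
  by apply/orP; right; lia.
- by rewrite subrr sub0mx.
Qed.

Variable a : nat.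
Hypotheses (r_def : r = (a * b)%N) (a_gt1 : (1 < a)%N).
Hypothesis p_ndvd_a : ~~ (p %| a)%N.

Let g i := if i == 0%N then (q + r + b)%N else if (i < b)%N then (q + r)%N else
  if i == b then (q + r - b)%N else q.

Definition lambda_qb1 : r.-tuple nat := [tuple g i | i < r].

Lemma is_lambda_qb1 : is_lambda (q + b + 1) p lambda_qb1.
Proof.
have s_gt0 : (0 < q + b + 1)%N by rewrite addn1.
have lt_br : (b < r)%N by rewrite r_def -{1}(mul1n b) ltn_mul2r b_gt0.
split=> [||F pcharFp].
- apply: sorted_geq_mktuple => i j lt_ij; rewrite /g.
  by repeat case: ifP; lia.
- apply/allP=> _ /mapP[i _ ->]; rewrite /g.
  by repeat case: ifP; lia.
pose w := monomial F r_gt0 s_gt0; pose N := tensor_nilp F r (q + b + 1).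
have a_neq0 : a%:R != 0 :> F by rewrite -(dvdn_pcharf pcharFp).
(* N^(q + r) maps 1 to a X^(r - b) Y^(q + b) and N^(q + r - b) maps Y^b to      *)
(* X^(r - b) Y^(q + b), whence the correction term, in which a is invertible.   *)
pose v i :=
  if i == b then w 0%N b - a%:R^-1 *: (w 0%N 0%N *m N ^+ b) else w 0%N i.
apply: (tensor_jordan_formI (r_gt0 := r_gt0) (s_gt0 := s_gt0)
         (v := fun i => v i) pr_p pcharFp le_rq) => [|i|i].
(* Adding b for every i <= b removes the subtraction in [g] and makes the summand a combination of
   indicator functions. *)
- apply: (@addnI (\sum_(i < r) b * (i < b.+1))%N).
  rewrite -big_split.
  transitivity
    (\sum_(i < r) (q + r * (i < b.+1) + b * (i < 1) + b * (i < b)))%N.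
    apply: eq_bigr => i _; rewrite tnth_mktuple /g ltnS ltnS leqn0.
    by case: posnP => [-> | _]; [rewrite b_gt0 /= | case: ltngtP => _ /=]; lia.
  rewrite !big_split -!big_distrr !sum_ord_ltn //= sum_nat_const card_ord.
  lia.
- have wX1 j : w 0%N j *m N ^+ q = w 0%N (j + q)%N.
    by rewrite -[q in _ ^+ q]muln1 monomial_nilpX_shift // muln1.
  have w_nil k j : (r <= k)%N || (q + b + 1 <= j)%N -> w k j = 0.
    exact: monomial_nil.
  have r_eq : r = (b * a.-1.+1)%N by rewrite prednK 1?ltnW // mulnC.
  have wqr : w 0%N q *m N ^+ r = w (b * a.-1)%N (q + b)%N *+ a.
    rewrite [X in _ ^+ X]r_eq monomial_nilpX_top2 //; last by lia.
    rewrite -/w -/b -r_eq !add0n (w_nil r q) ?leqnn // (w_nil r) ?leqnn //.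
    by rewrite add0r addr0 prednK 1?ltnW.
  rewrite tnth_mktuple /v /g; have [i0 | i_neq0] := eqVneq (i : nat) 0%N.
    (* N^(q + r) leaves a X^(r - b) Y^(q + b), on which the remaining N^b acts as X^b. *)
    rewrite i0 ltn_eqF // !exprD -!mulmxE !mulmxA wX1 wqr -scaler_nat -scalemxAl.
    rewrite -[b in N ^+ b]muln1 monomial_nilpX_top //; last by lia.
    by rewrite -/w -/b w_nil ?scaler0 // muln1 -mulnSr -r_eq leqnn.
  have [lt_ib | le_bi] := ltnP i b.
    rewrite ltn_eqF // exprD -mulmxE mulmxA wX1.
    rewrite [X in _ ^+ X]r_eq monomial_nilpX_top //; last by lia.
    by rewrite -/w -/b w_nil // -r_eq leqnn.
  case: eqP => [i_b | /eqP i_neqb]; last first.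
    by rewrite wX1 w_nil //; apply/orP; right; lia.
  have exp_eq : (q + r - b = q + b * a.-1)%N by rewrite r_eq mulnS; lia.
  have Nqr : w 0%N 0%N *m N ^+ b *m N ^+ (q + r - b) = w 0%N q *m N ^+ r.
    have <- : w 0%N 0%N *m N ^+ q = w 0%N q by rewrite wX1.
    rewrite -!mulmxA; congr (_ *m _).
    by rewrite mulmxE -!exprD subnKC //; lia.
  rewrite mulmxBl -scalemxAl Nqr wqr.
  rewrite exp_eq exprD -mulmxE mulmxA wX1 monomial_nilpX_top //; last by lia.
  rewrite -/w -/b add0n -scaler_nat scalerA mulVf // scale1r [(b + q)%N]addnC.
  exact: subrr.
- rewrite /v; case: eqP => [-> | _]; last by rewrite subrr sub0mx.
  rewrite opprB addrC subrK scalemx_sub //.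
  have -> : N ^+ b = N ^+ b.-1 * N by rewrite -exprSr prednK.
  by rewrite -mulmxE mulmxA submxMl.
Qed.

End PPower.
End Lambda.

Local Close Scope ring_scope.

Local Open Scope group_scope.

(** * Permutations acting on residue classes *)

Section TpermGenerated.
Variables (T : finType) (G : {group {perm T}}).

Lemma tperm_trans x y z : tperm x y \in G -> tperm y z \in G -> tperm x z \in G.
Proof.
move=> Gxy Gyz; have [-> //|ne_xy] := eqVneq x y.
have [->|ne_xz] := eqVneq x z; first by rewrite tperm1 group1.
have -> : tperm x z = tperm x y ^ tperm y z.
  by rewrite tpermJ tpermL tpermD // eq_sym.
exact: groupJ.
Qed.

(** Induction on the number of moved points: s followed by the transposition of x and s x also fixes
    x, and its own transpositions stay in G by [tperm_trans]. *)
Lemma mem_of_tperm (s : {perm T}) : (forall x, tperm x (s x) \in G) -> s \in G.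
Proof.
have [n] := ubnP #|[set x | s x != x]|; elim: n s => // n IHn s.
rewrite ltnS => le_n Gs.
have [x /= ne_x | fix_s] := pickP (fun x => s x != x); last first.
  have -> : s = 1; last exact: group1.
  by apply/permP=> x; rewrite perm1; apply/eqP/negbFE/fix_s.
rewrite -(mulgK (tperm x (s x)) s) groupM ?groupV //.
apply: IHn => [|y].
  apply: leq_trans le_n; apply: proper_card; apply/properP; split.
    apply/subsetP=> y; rewrite !inE permM; apply: contra_neq => fix_y.
    rewrite fix_y tpermD //.
      by apply/eqP=> x_y; rewrite x_y fix_y eqxx in ne_x.
    rewrite -fix_y (inj_eq perm_inj); apply/eqP=> x_y.
    by rewrite x_y fix_y eqxx in ne_x.
  by exists x; rewrite !inE ?permM ?tpermR ?eqxx.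
rewrite permM; case: tpermP => [s_y | s_y | _ _].
- by apply: tperm_trans (Gs x); rewrite -s_y.
- by rewrite (perm_inj s_y) tperm1.
- exact: Gs.
Qed.

End TpermGenerated.

Section Residues.
Variables r b : nat.
Hypotheses (r_gt0 : (0 < r)%N) (b_dvd_r : b %| r).
Let b_gt0 : 0 < b. Proof. exact: dvdn_gt0 r_gt0 b_dvd_r. Qed.

Definition induces (s : 'S_r) (t : 'S_b) :=
  [forall i : 'I_r, forall j : 'I_b, (i %% b == j) ==> (s i %% b == t j)].

Implicit Types (s : 'S_r) (t : 'S_b).

Lemma inducesP s t :
  reflect (forall (i : 'I_r) (j : 'I_b), i %% b = j -> s i %% b = t j)
          (induces s t).
Proof.
by apply: (iffP 'forall_'forall_implyP) => st i j /eqP/st => [/eqP | ->].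
Qed.

Lemma induces1 : induces 1 1.
Proof. by apply/inducesP=> i j; rewrite !perm1. Qed.

Lemma inducesM s s' t t' :
  induces s t -> induces s' t' -> induces (s * s') (t * t').
Proof.
move=> /inducesP st /inducesP st'.
by apply/inducesP=> i j /st/st'; rewrite !permM.
Qed.

Lemma induces_mod s t i j :
  induces s t -> (s i = s j %[mod b] <-> i = j %[mod b]).
Proof.
move=> /inducesP st; have lt_mod k : k %% b < b by rewrite ltn_mod.
rewrite (st i (Ordinal (lt_mod i))) // (st j (Ordinal (lt_mod j))) //.
split=> [/val_inj/perm_inj[] // | ij]; congr (t _ : nat); exact: val_inj.
Qed.

Definition residue_perms : {set 'S_r} :=
  [set s | [exists t in dihedral_group b, induces s t]].

Lemma residue_permsP s :
  reflect (exists2 t, t \in dihedral_group b & induces s t) (s \in residue_perms).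
Proof. by rewrite inE; apply: exists_inP. Qed.

Lemma residue_perms_group_set : group_set residue_perms.
Proof.
apply/group_setP; split=> [|s s'].
  by apply/residue_permsP; exists 1; rewrite ?group1 ?induces1.
move=> /residue_permsP[t Dt st] /residue_permsP[t' Dt' st'].
by apply/residue_permsP; exists (t * t'); rewrite ?groupM ?inducesM.
Qed.
Canonical residue_perms_group := Group residue_perms_group_set.

End Residues.

Section Dihedral.
Variable b : nat.
Let rot := perm (@ordS_inj b).
Let flip := perm (@rev_ord_inj b).

(** For b = 2 the rotation is already the transposition, so the small cases need no separate
    treatment later. *)
Lemma dihedral_groupE : 0 < b -> dihedral_group b :=: <<[set rot; flip]>>.
Proof.
rewrite /dihedral_group; case: (leqP b 2) => // le_b2 b_gt0; apply/esym/eqP.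
rewrite eqEsubset subsetT /=; apply/subsetP=> s _.
rewrite /rot /flip; case: b le_b2 b_gt0 s => [//|[|[|//]]] _ _ s.
  have -> : s = 1; last exact: group1.
  by apply/permP=> i; rewrite !ord1.
have s_ne : (s ord0 != s ord_max :> nat) by rewrite val_eqE (inj_eq perm_inj).
have eq_perm2 (t t' : 'S_2) :
    t ord0 = t' ord0 -> t ord_max = t' ord_max -> t = t'.
  move=> t0 t1; apply/permP=> -[[|[|//]] lt_i2].
    by rewrite (_ : Ordinal lt_i2 = ord0) //; apply: val_inj.
  by rewrite (_ : Ordinal lt_i2 = ord_max) //; apply: val_inj.
have := (ltn_ord (s ord0), ltn_ord (s ord_max)) => -[lt_0 lt_1].
have [s0 | s0] := eqVneq (s ord0 : nat) 0.
  have -> : s = 1; last exact: group1.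
  by apply: eq_perm2; apply: val_inj; rewrite perm1 /=; lia.
have -> : s = perm (@ordS_inj 2); last by rewrite mem_gen // !inE eqxx.
by apply: eq_perm2; apply: val_inj; rewrite permE /=; lia.
Qed.

Lemma rotX k i : (rot ^+ k) i = (i + k) %% b :> nat.
Proof.
elim: k => [|k IHk]; first by rewrite perm1 addn0 modn_small.
by rewrite expgSr permM permE /= IHk -addn1 modnDml -addnA addn1.
Qed.

Lemma flip_rotX k i : (flip * rot ^+ k) i = (b - i.+1 + k) %% b :> nat.
Proof. by rewrite permM rotX permE. Qed.

Lemma flip_rotX_dihedral k : 0 < b -> flip * rot ^+ k \in dihedral_group b.
Proof.
move=> b_gt0; rewrite dihedral_groupE //.
by rewrite groupM ?groupX ?mem_gen ?inE ?eqxx ?orbT.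
Qed.

End Dihedral.

(** Modulo b both r and the parts vanish, which leaves i |-> s - 1 - i: the reflection followed by s
    rotations. *)
Lemma is_pi_residue (p m r s : nat) (sigma : 'S_r) : prime p -> 0 < r ->
  (p ^ m)%N %| r -> is_pi s p sigma -> sigma \in residue_perms r (p ^ m)%N.
Proof.
set b := (p ^ m)%N => pr_p r_gt0 b_dvd_r [lam [_ /allP lam_gt0 lamJ] sigmaE].
have b_gt0 := dvdn_gt0 r_gt0 b_dvd_r.
have dvd_lam i : b %| tnth lam i.
  apply: (tensor_jordan_form_dvd (F := 'F_p) (s := s)) => //.
  - exact: pchar_Fp.
  - exact/lamJ/pchar_Fp.
  - by rewrite lam_gt0 ?mem_tnth.
have sigma_add i : sigma i + i.+1 = s %[mod b].
  have := sigmaE i; rewrite subSS => sig.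
  have {}sig : (sigma i + i.+1 + tnth lam i = s + r)%N by have := ltn_ord i; lia.
  have /dvdnP[c lam_def] := dvd_lam i; have /dvdnP[d r_def] := b_dvd_r.
  have := congr1 (modn^~ b) sig; rewrite lam_def [in s + r]r_def.
  by rewrite addnC (addnC s) !modnMDl.
apply/residue_permsP; exists (perm (@rev_ord_inj b) * perm (@ordS_inj b) ^+ s).
  exact: flip_rotX_dihedral.
apply/inducesP=> i j ij; rewrite flip_rotX; apply/eqP.
rewrite -(eqn_modDr i.+1) sigma_add; apply/eqP; have lt_jb := ltn_ord j.
have -> : (b - j.+1 + s + i.+1 = (i %/ b).+1 * b + s)%N.
  by have := divn_eq i b; rewrite ij mulSn; lia.
by rewrite modnMDl.
Qed.

(** * Generation by four flips *)

Lemma perm_of_involution r (f : nat -> nat) :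
  (forall i, i < r -> f i < r) -> (forall i, i < r -> f (f i) = i) ->
  exists s : 'S_r, forall i, s i = f i :> nat.
Proof.
move=> f_lt fK; pose g (i : 'I_r) := Ordinal (f_lt i (ltn_ord i)).
have gK : involutive g by move=> i; apply: val_inj; rewrite /= fK.
by exists (perm (inv_inj gK)) => i; rewrite permE.
Qed.

(* pi(r, q, p), pi(r, q + 1, p) and pi(r, q + b, p), shifted to start at 0,     *)
(* are [flip_two r c] for c = 0, 1, b, and pi(r, q + b + 1, p) is               *)
(* [flip_three r b]; here q >= r is a power of p.                               *)
Definition flip_two r c i := if i < c then c - i.+1 else r + c - i.+1.
Definition flip_three r b i :=
  if i == 0 then 0 else
  if i < b then b - i else if i == b then b else r + b - i.

Lemma perm_of_flip_two r c :
  c <= r -> exists s : 'S_r, forall i, s i = flip_two r c i :> nat.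
Proof.
move=> le_cr; apply: perm_of_involution => i lt_ir; rewrite /flip_two.
  by case: ifP; lia.
by repeat case: ifP; lia.
Qed.

Section Generation.
Variables (r b : nat) (G : {group 'S_r}).
Hypotheses (r_gt0 : 0 < r) (b_dvd_r : b %| r).
Variables s0 s1 sb : 'S_r.
Hypotheses (s0E : forall i, s0 i = flip_two r 0 i :> nat)
           (s1E : forall i, s1 i = flip_two r 1 i :> nat)
           (sbE : forall i, sb i = flip_two r b i :> nat).
Hypotheses (Gs0 : s0 \in G) (Gs1 : s1 \in G) (Gsb : sb \in G).
Hypothesis Gsb1 : b < r -> exists2 s : 'S_r, s \in G &
  forall i, s i = flip_three r b i :> nat.
Let b_gt0 : 0 < b. Proof. exact: dvdn_gt0 r_gt0 b_dvd_r. Qed.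
Let le_br : b <= r. Proof. exact: dvdn_leq. Qed.
Let rho := s0 * s1.

(** Modulo r, [s0] is i |-> -1 - i and [s1] is i |-> -i. *)
Lemma rhoX k i : (rho ^+ k) i = (i + k) %% r :> nat.
Proof.
elim: k => [|k IHk]; first by rewrite perm1 addn0 modn_small.
have -> : (i + k.+1) %% r = ((i + k) %% r + 1) %% r.
  by rewrite modnDml addn1 addnS.
rewrite expgSr permM permM s1E s0E /flip_two /= IHk.
have : (i + k) %% r < r by rewrite ltn_mod.
set l := _ %% r; case: (ltnP (l + 1) r) => [lt_l | le_l] lt_lr.
  by rewrite modn_small //; case: ifP; lia.
have -> : l + 1 = r by lia.
by rewrite modnn; case: ifP; lia.
Qed.

Let lt_rb : r - b < r. Proof. by lia. Qed.

(** [s0 * sb] is the rotation by b modulo r; [s1 * sb1] agrees with it except that the images of 0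
    and r - b are interchanged. *)
Lemma tperm_rb_mem : b < r -> tperm (Ordinal r_gt0) (Ordinal lt_rb) \in G.
Proof.
move=> lt_br; have [sb1 Gsb1' sb1E] := Gsb1 lt_br.
suff -> : tperm (Ordinal r_gt0) (Ordinal lt_rb) = s1 * sb1 * (s0 * sb)^-1.
  by rewrite !(groupM, groupV).
apply/(canRL (mulgK _))/permP=> i; apply: val_inj.
rewrite /= !permM sb1E s1E sbE s0E /flip_three /flip_two.
have lt_ir := ltn_ord i.
case: tpermP => [-> | -> | /eqP ne0 /eqP neb] /=.
- by repeat case: ifP; lia.
- by repeat case: ifP; lia.
rewrite -!val_eqE /= in ne0 neb.
by repeat case: ifP; lia.
Qed.

Lemma tperm_residue_mem (i j : 'I_r) : i = j %[mod b] -> tperm i j \in G.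
Proof.
have Grho k : rho ^+ k \in G by rewrite groupX ?groupM.
(* Conjugation by [rho ^+ k] takes 0 to k and r - b to k - b; such steps then lead from k down to k
   modulo b. *)
have stepG (k : 'I_r) (lt_k : k - b < r) :
    b <= k -> tperm k (Ordinal lt_k) \in G.
  move=> le_bk; have lt_br := leq_ltn_trans le_bk (ltn_ord k).
  have := groupJ (tperm_rb_mem lt_br) (Grho k); rewrite tpermJ.
  congr (tperm _ _ \in G); apply: ord_inj; rewrite rhoX /=.
    by rewrite add0n modn_small.
  have -> : (r - b + k = k - b + r)%N by lia.
  by rewrite modnDr modn_small.
have lt_mod (k : 'I_r) : k %% b < r by rewrite (leq_ltn_trans (leq_mod _ _)).
have modG (k : 'I_r) : tperm k (Ordinal (lt_mod k)) \in G.
  have [n] := ubnP (k : nat); elim: n k => // n IHn k /ltnSE-le_kn.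
  have [lt_kb | le_bk] := ltnP k b.
    rewrite (_ : Ordinal _ = k) ?tperm1 ?group1 //.
    by apply: val_inj; rewrite /= modn_small.
  have lt_k : k - b < r by rewrite (leq_ltn_trans (leq_subr _ _)).
  apply: tperm_trans (stepG k lt_k le_bk) _.
  have := IHn (Ordinal lt_k); rewrite (leq_trans _ le_kn) /=; last by lia.
  move/(_ isT); congr (tperm _ _ \in G); apply: val_inj => /=.
  by rewrite -{2}(subnK le_bk) modnDr.
move=> ij; apply: tperm_trans (modG i) _.
rewrite (_ : Ordinal (lt_mod i) = Ordinal (lt_mod j)); last exact: val_inj.
by rewrite tpermC.
Qed.

Lemma induces_lift t :
  t \in dihedral_group b -> exists2 s, s \in G & induces s t.
Proof.
pose L := [set t : 'S_b | [exists s in G, induces s t]].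
have LP t' : reflect (exists2 s, s \in G & induces s t') (t' \in L).
  by rewrite inE; apply: exists_inP.
have L_group : group_set L.
  apply/group_setP; split=> [|x y /LP[s Gs sx] /LP[s' Gs' sy]].
    by apply/LP; exists 1; rewrite ?group1 ?induces1.
  by apply/LP; exists (s * s'); rewrite ?groupM ?inducesM.
rewrite dihedral_groupE // => Dt; apply/LP.
suff /subsetP-> : <<[set perm (@ordS_inj b); perm (@rev_ord_inj b)]>>
  \subset Group L_group by [].
rewrite gen_subG; apply/subsetP=> x; rewrite !inE => /orP[] /eqP->.
  apply/exists_inP; exists rho; first exact: groupM.
  apply/inducesP=> i j ij; rewrite -[rho]expg1 rhoX permE /= -ij.
  by rewrite modn_dvdm // -(addn1 (i %% b)) modnDml.
apply/exists_inP; exists s0 => //; apply/inducesP=> i j ij.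
rewrite s0E permE /=.
rewrite /flip_two /=; have lt_ir := ltn_ord i; have lt_jb := ltn_ord j.
have [d r_def] := dvdnP b_dvd_r.
have := divn_eq i b; rewrite ij => i_def.
have -> : (r + 0 - i.+1 = (d - (i %/ b).+1) * b + (b - j.+1))%N.
  have lt_d : i %/ b < d by rewrite ltn_divLR // -r_def.
  rewrite mulnBl; nia.
by rewrite modnMDl modn_small //; lia.
Qed.

(** Dividing s by a lift g in G of its action on the classes leaves a permutation that preserves
    every class, and the transpositions within classes lie in G. *)
Lemma residue_perms_sub : residue_perms r b \subset G.
Proof.
apply/subsetP=> s /residue_permsP[t Dt st]; have [g Gg gt] := induces_lift Dt.
rewrite -(mulgKV g s) groupM //.
apply: mem_of_tperm => i; apply: tperm_residue_mem.
apply/(induces_mod r_gt0 b_dvd_r _ _ gt); rewrite permM permKV.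
move/inducesP: st => st; move/inducesP: gt => gt.
have lt_mod : i %% b < b by rewrite ltn_mod.
by rewrite (st i (Ordinal lt_mod)) // (gt i (Ordinal lt_mod)).
Qed.

End Generation.

(** * Determination of G(r, p) *)

Lemma is_pi_mem r p s (sigma : 'S_r) :
  r <= s -> is_pi s p sigma -> sigma \in G_group r p.
Proof.
move=> le_rs pi_sigma; apply: mem_gen.
by rewrite inE; apply/asboolP; exists s.
Qed.

Lemma flip_q_mem r p : prime p -> 0 < r ->
  exists2 s : 'S_r, s \in G_group r p & forall i, s i = flip_two r 0 i :> nat.
Proof.
move=> pr_p r_gt0; have lt_rq : r < (p ^ r)%N by rewrite ltn_expl ?prime_gt1.
have [s sE] := @perm_of_flip_two r 0 isT; exists s => //.
apply: (@is_pi_mem _ _ (p ^ r)%N) => //; first exact: ltnW.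
exists (lambda_q p r r) => [|i].
  by apply: is_lambda_q => //; apply: ltnW.
by rewrite sE tnth_mktuple /flip_two /=; have := ltn_ord i; lia.
Qed.

Lemma flip_qb_mem r p m : prime p -> 0 < r -> (p ^ m)%N %| r ->
  exists2 s : 'S_r, s \in G_group r p
    & forall i, s i = flip_two r (p ^ m)%N i :> nat.
Proof.
move=> pr_p r_gt0 b_dvd_r.
have lt_rq : r < (p ^ r)%N by rewrite ltn_expl ?prime_gt1.
have [s sE] := perm_of_flip_two (dvdn_leq r_gt0 b_dvd_r); exists s => //.
apply: (@is_pi_mem _ _ (p ^ r + p ^ m)%N) => //; first by rewrite ltnW ?ltn_addr.
exists (lambda_qb p r r m) => [|i].
  by apply: is_lambda_qb => //; apply: ltnW.
by rewrite sE tnth_mktuple /flip_two; have := ltn_ord i; case: ifP; lia.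
Qed.

Lemma flip_qb1_mem r p m a :
  prime p -> 0 < r -> r = (a * p ^ m)%N -> 1 < a -> ~~ (p %| a) ->
  exists2 s : 'S_r, s \in G_group r p
    & forall i, s i = flip_three r (p ^ m)%N i :> nat.
Proof.
move=> pr_p r_gt0 r_def a_gt1 p_ndvd_a.
have lt_rq : r < (p ^ r)%N by rewrite ltn_expl ?prime_gt1.
have b_gt0 : 0 < (p ^ m)%N by rewrite expn_gt0 prime_gt0.
have lt_br : (p ^ m)%N < r.
  by rewrite r_def -{1}(mul1n (p ^ m)%N) ltn_mul2r b_gt0.
have [|i lt_ir|s sE] := @perm_of_involution r (flip_three r (p ^ m)%N).
- by move=> i lt_ir; rewrite /flip_three; repeat case: ifP; lia.
- by rewrite /flip_three; repeat case: ifP; lia.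
exists s => //; apply: (@is_pi_mem _ _ (p ^ r + p ^ m + 1)%N) => //.
  by rewrite -addnA ltnW ?ltn_addr.
exists (lambda_qb1 p r r m) => [|i].
  apply: (is_lambda_qb1 pr_p r_gt0 (ltnW lt_rq) _ r_def) => //.
  by rewrite r_def dvdn_mull.
rewrite sE tnth_mktuple /flip_three; have := ltn_ord i.
by repeat case: ifP; lia.
Qed.

Lemma G_groupE r p m a : prime p -> 0 < r -> r = (a * p ^ m)%N -> ~~ (p %| a) ->
  G_group r p :=: residue_perms r (p ^ m)%N.
Proof.
move=> pr_p r_gt0 r_def p_ndvd_a.
have b_dvd_r : (p ^ m)%N %| r by rewrite r_def dvdn_mull.
apply/eqP; rewrite eqEsubset; apply/andP; split.
  rewrite gen_subG; apply/subsetP=> s; rewrite inE => /asboolP[k _].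
  exact: is_pi_residue.
have [s0 Gs0 s0E] := flip_q_mem pr_p r_gt0.
(* The exponent 0 makes this the flip for s = q + 1. *)
have [s1 Gs1 s1E] := @flip_qb_mem r p 0 pr_p r_gt0 (dvd1n r).
have [sb Gsb sbE] := flip_qb_mem pr_p r_gt0 b_dvd_r.
apply: (residue_perms_sub r_gt0 b_dvd_r s0E s1E sbE) => // lt_br.
apply: (flip_qb1_mem pr_p r_gt0 r_def _ p_ndvd_a).
move: lt_br; rewrite [X in _ < X]r_def -{1}(mul1n (p ^ m)%N) ltn_mul2r.
by case/andP.
Qed.

(** Here b = 1: there is a single residue class, so every permutation qualifies. *)
Lemma G_group_p' r p :
  prime p -> 0 < r -> ~~ (p %| r) -> G_group r p = [set: 'S_r]%G.
Proof.
move=> pr_p r_gt0 p_ndvd_r; apply/val_inj.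
rewrite /= (@G_groupE r p 0 r pr_p r_gt0 _ p_ndvd_r) ?muln1 //.
apply/setP=> s; rewrite [RHS]inE; apply/residue_permsP.
exists 1; rewrite ?group1 //.
by apply/inducesP=> i j _; rewrite modn1 [_ j]ord1.
Qed.

(** Here a = 1: every residue class is a point, so a permutation induces only itself. *)
Lemma G_group_ppower b p m :
  prime p -> b = (p ^ m)%N -> G_group b p = dihedral_group b.
Proof.
move=> pr_p b_def; have b_gt0 : 0 < b by rewrite b_def expn_gt0 prime_gt0.
apply/val_inj; rewrite /= (@G_groupE b p m 1 pr_p b_gt0) ?mul1n -?b_def //;
  last first.
  by rewrite dvdn1 neq_ltn prime_gt1 ?orbT.
apply/setP=> s; apply/residue_permsP/idP=> [[t Dt /inducesP st] | Ds].
  suff -> : s = t by [].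
  by apply/permP=> i; apply: ord_inj; rewrite -(st i i) modn_small.
exists s => //; apply/inducesP=> i j; rewrite !modn_small // => ij.
by rewrite (_ : i = j) //; apply: ord_inj.
Qed.

(** * The imprimitive action of the wreath product *)

Section WreathEmbedding.
Variables a b : nat.
Hypothesis a_gt0 : 0 < a.
Local Notation W := (wreath_type [set: 'S_a]%G (dihedral_group b)).
Implicit Types u v : W.

(* u = (s, f) stands for the product s * f in the semidirect product, so that   *)
(* s acts first.                                                                *)
Definition wreath_fun u (k : 'I_(a * b)) : 'I_(a * b) :=
  let ij := mxtens_unindex k in
  mxtens_index (u.2 (u.1 ij.2) ij.1, u.1 ij.2).

Lemma wreath_fun_inj u : injective (wreath_fun u).
Proof.
move=> k k' /(can_inj (@mxtens_indexK _ _)) [] e1 /perm_inj e2; move: e1.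
rewrite e2 => /perm_inj e1.
apply: (can_inj (@mxtens_unindexK _ _)).
exact: (congr2 pair e1 e2).
Qed.

Definition wreath_perm u : 'S_(a * b) := perm (@wreath_fun_inj u).

Lemma wreath_permE u i j :
  wreath_perm u (mxtens_index (i, j)) = mxtens_index (u.2 (u.1 j) i, u.1 j).
Proof. by rewrite permE /wreath_fun mxtens_indexK. Qed.

Lemma wreath_permM : {morph wreath_perm : u v / u * v}.
Proof.
move=> u v; apply/permP=> k; case: (mxtens_indexP k) => i j.
rewrite permM !wreath_permE; congr (mxtens_index (_, _)); last first.
  by rewrite /= permM.
case: u v => [[s f] /= /setXP[Ds _]] [[s' f'] /= /setXP[Ds' _]].
rewrite mulg_ffun /= permM; congr (f' _ _); first by rewrite permM.
(* The action in the semidirect product is a restriction, which is [coord_perm] only on members of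
   the base group. *)
rewrite actbyE //; last by apply/setXnP=> l; rewrite inE.
by rewrite /= ffunE permM permK.
Qed.

Canonical wreath_perm_morphism :=
  @Morphism _ _ [set: W] wreath_perm (in2W wreath_permM).

Lemma injm_wreath_perm : 'injm wreath_perm.
Proof.
apply/injmP=> u v _ _ /permP uv; apply: val_inj.
have uvE i j : u.1 j = v.1 j /\ u.2 (u.1 j) i = v.2 (v.1 j) i.
  have := uv (mxtens_index (i, j)); rewrite !wreath_permE.
  by move=> /(can_inj (@mxtens_indexK _ _)) [].
have s_eq : u.1 = v.1.
  by apply/permP=> j; case: (uvE (Ordinal a_gt0) j).
case: u v => [[s f] /= ?] [[s' f'] /= ?] in uv uvE s_eq *.
rewrite s_eq; congr (_, _); apply/ffunP=> j; apply/permP=> i.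
by have [_] := uvE i (s'^-1 j); rewrite s_eq permKV.
Qed.

(** [mxtens_index (i, j)] is i * b + j, so j is the residue class and i the position in it. *)
Lemma im_wreath_perm : wreath_perm @* [set: W] = residue_perms (a * b) b.
Proof.
have b_dvd : b %| (a * b)%N by rewrite dvdn_mull.
apply/setP=> g; apply/morphimP/residue_permsP => [[u _ _ ->] | [t Dt /inducesP gt]].
  exists u.1; first by case: u => [[s f] /= /setXP[]].
  apply/inducesP=> k j; case: (mxtens_indexP k) => i j' /=.
  rewrite modnMDl modn_small // => j'_j.
  rewrite wreath_permE /= modnMDl modn_small //.
  by congr (u.1 _ : nat); apply: ord_inj.
have gE i j : g (mxtens_index (i, j)) =
    mxtens_index ((mxtens_unindex (g (mxtens_index (i, j)))).1, t j).
  rewrite -[LHS]mxtens_unindexK; congr (mxtens_index (_, _)).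
  by apply: ord_inj; rewrite /= (gt _ j) //= modnMDl modn_small.
(* The coordinates are indexed by the target class, since in [wreath_fun] the class moves first;
   hence the inverse of t. *)
pose f j i := (mxtens_unindex (g (mxtens_index (i, t^-1 j)))).1.
have f_inj j : injective (f j).
  move=> i i' f_eq.
  have : g (mxtens_index (i, t^-1 j)) = g (mxtens_index (i', t^-1 j)).
    by rewrite gE [RHS]gE; congr (mxtens_index (_, _)).
  by move=> /perm_inj/(can_inj (@mxtens_indexK _ _)) [].
pose F : {dffun forall _ : 'I_b, 'S_a} := [ffun j => perm (f_inj j)].
have FP : (t, F) \in setX (dihedral_group b) (base_group b [set: 'S_a]%G).
  by rewrite inE Dt; apply/setXnP=> j; rewrite inE.
exists (SdPair _ FP) => //; apply/permP=> k; case: (mxtens_indexP k) => i j.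
by rewrite wreath_permE /= ffunE permE /f permK gE mxtens_indexK.
Qed.

Lemma residue_perms_isog_wreath :
  residue_perms (a * b) b \isog wreath [set: 'S_a]%G (dihedral_group b).
Proof.
rewrite isog_sym; apply/isogP; exists wreath_perm_morphism.
  exact: injm_wreath_perm.
exact: im_wreath_perm.
Qed.

End WreathEmbedding.

Local Close Scope group_scope.

Theorem theorem2p5 (p r a b : nat) (pr_p : prime p) (r_gt0 : (0 < r)%N)
    (def_a : a = r`_p^') (def_b : b = r`_p) :
  (G_group r p \isog wreath (G_group a p) (G_group b p)) /\
  (wreath (G_group a p) (G_group b p) \isog
     wreath [set: 'S_a]%G (dihedral_group b)).
Proof.
have b_def : b = (p ^ logn p r)%N by rewrite def_b p_part.
have r_def : r = (a * b)%N by rewrite def_a def_b mulnC partnC.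
have a_gt0 : (0 < a)%N by rewrite def_a part_gt0.
have p_ndvd_a : ~~ (p %| a)%N by rewrite -p'natE // def_a part_pnat.
rewrite (G_group_p' pr_p a_gt0 p_ndvd_a) (G_group_ppower pr_p b_def).
split; last exact: isog_refl.
have -> : G_group r p = residue_perms_group r b.
  apply/val_inj; rewrite /= b_def.
  by rewrite (@G_groupE r p (logn p r) a) // -b_def.
rewrite r_def; exact: residue_perms_isog_wreath.
Qed.
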